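(* The following dichotomy holds true: (a) either there exists a bounded operator $T$ on an infinite-dimensional separable Hilbert space which has no non-trivial invariant closed subset; (b) or every bounded operator $T$ acting on an infinite-dimensional separable Hilbert space such that the closure of every orbit of $T$ is a subspace and such that $T$ is orbit-unicellular has the following property: there exists a family of closures of orbits of $T$ which, ordered by inclusion, is order isomorphic to $(\mathbb{R},\leq)$. In particular such an operator has uncountably many distinct closures of orbits.
   Context: Hilbert spaces are over a fixed scalar field $\mathbb{K}=\mathbb{R}$ or $\mathbb{C}$. For a bounded operator $T$ on $H$ and $x\in H$, the orbit of $x$ is $\mathcal{O}rb(x,T)=\{T^{n}x : n\geq 0\}$, with closure $\overline{\mathcal{O}rb}(x,T)$. A (nonempty) closed subset $F$ of $H$ is invariant if $T(F)\subseteq F$, and non-trivial if $F\neq\{0\}$ and $F\neq H$. $T$ is orbit-unicellular if for all $x,y\in H$ either $\overline{\mathcal{O}rb}(x,T)\subseteq\overline{\mathcal{O}rb}(y,T)$ or $\overline{\mathcal{O}rb}(y,T)\subseteq\overline{\mathcal{O}rb}(x,T)$. *)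

(* Defs.v *)
From HB Require Import structures.
From mathcomp Require Import all_boot all_order all_algebra.
From mathcomp Require Import complex.
From mathcomp Require Import all_classical all_reals topology normedtype.

Set Implicit Arguments.
Unset Strict Implicit.
Unset Printing Implicit Defensive.

Import Order.TTheory GRing.Theory Num.Theory.
Import numFieldNormedType.Exports.

Local Open Scope classical_set_scope.
Local Open Scope ring_scope.

Variant scalar_kind := RealScalars | ComplexScalars.

Definition scalars (R : realType) (k : scalar_kind) : numFieldType :=
  match k with
  | RealScalars => R
  | ComplexScalars => R[i]
  end.

Definition scalar_conj (R : realType) (k : scalar_kind) :
    scalars R k -> scalars R k :=
  match k with
  | RealScalars => idfun
  | ComplexScalars => (Num.conj : R[i] -> R[i])
  end.

(* Only the norm is kept as data: by polarization it determines the inner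
   product. The norm of a normedModType over K takes its values in K. *)
Definition hilbert (R : realType) (k : scalar_kind)
    (H : completeNormedModType (scalars R k)) : Prop :=
  exists dot : {dot H for @scalar_conj R k}, forall x : H, `|x| ^+ 2 = dot x x.

Definition finite_dimensional (K : numFieldType) (V : lmodType K) : Prop :=
  exists (n : nat) (e : 'I_n -> V),
    forall x : V, exists c : 'I_n -> K, x = \sum_(i < n) c i *: e i.

Definition infinite_dimensional (K : numFieldType) (V : lmodType K) : Prop :=
  ~ finite_dimensional V.

Definition separable_space (X : topologicalType) : Prop :=
  exists D : set X, countable D /\ dense D.

Definition inf_dim_sep_hilbert (R : realType) (k : scalar_kind)
    (H : completeNormedModType (scalars R k)) : Prop :=
  [/\ hilbert H, infinite_dimensional H & separable_space H].

Section Operators.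
Variables (K : numFieldType) (H : normedModType K).
Implicit Types (T : {linear H -> H}) (F : set H).

Definition bounded_operator T : Prop :=
  exists M : K, forall x : H, `|T x| <= M * `|x|.

Definition linear_subspace F : Prop :=
  F 0 /\ forall (a : K) (x y : H), F x -> F y -> F (a *: x + y).

Definition orb T (x : H) : set H := [set iter n T x | n in [set: nat]].

Definition orb_closure T (x : H) : set H := closure (orb T x).

Definition orb_closures T : set (set H) := range (orb_closure T).

Definition invariant_closed T F : Prop :=
  [/\ F !=set0, closed F & T @` F `<=` F].

Definition nontrivial F : Prop := F <> [set 0] /\ F <> [set: H].

Definition orbit_unicellular T : Prop :=
  forall x y : H, orb_closure T x `<=` orb_closure T y \/
                  orb_closure T y `<=` orb_closure T x.

End Operators.

Definition order_iso_real (R : realType) (X : Type) (C : set (set X)) : Prop :=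
  exists phi : R -> set X, set_bij [set: R] C phi /\
    forall s t : R, s <= t <-> phi s `<=` phi t.

(* Main.v *)
Require Import Defs.
From HB Require Import structures.
From mathcomp Require Import all_boot all_order all_algebra.
From mathcomp Require Import complex ring lra.
From mathcomp Require Import all_classical all_reals topology normedtype.
From mathcomp Require Import measure lebesgue_measure.

(** Call [M x] the closure of the orbit of [x]. Assume that every bounded
    operator on an infinite-dimensional separable Hilbert space has a
    non-trivial invariant closed subset, and let [T] satisfy the hypotheses of
    the second alternative: the sets [M x] are closed subspaces, totally
    ordered by inclusion. Two properties of this chain suffice.

    The chain is densely ordered ([orbit_closures_dense]). Suppose [M x] is
    strictly contained in [M y] with no orbit closure strictly between them.
    Let [L] be the orthogonal complement of [M x] in [M y], and compress [T] to
    [L]. For a non-zero [z] in [L], the closure [M z] lies in [M y] and not in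
    [M x], so it is [M y]; projecting to [L], every non-zero vector of [L] has a
    dense orbit under the compression ([compression_dense_orbits]). Hence the
    compression has no non-trivial invariant closed subset, and by assumption
    [L] has finite dimension. But no operator on a non-zero
    finite-dimensional space has a dense orbit
    ([dense_orbit_infinite_dimensional]): a Gram determinant of a vector and its
    iterates is multiplied by a constant at each step, so along an orbit its
    modulus is a geometric sequence, whereas density would bring that sequence
    close to 0 and also close to a value larger than its first term.

    Strictly increasing sequences in the chain have suprema in the chain
    ([orbit_closures_sup]). If [M (a n)] increases and is not eventually
    constant, the closure of the union contains a vector [x] that lies in no
    [M (a n)] ([increasing_union_escape]); by total ordering [M x] contains
    all of them, so it is their supremum.

    A dense preorder with such suprema and at least two levels contains a copy
    of the real line ([real_line_embeds]): send a number in ]0, 1] to the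
    supremum of the left endpoints met when its binary expansion drives a
    bisection. The real line being uncountable, so is the chain. *)

Set Implicit Arguments.
Unset Strict Implicit.
Unset Printing Implicit Defensive.

Import Order.TTheory GRing.Theory Num.Theory.
Import numFieldNormedType.Exports.

Local Open Scope classical_set_scope.
Local Open Scope ring_scope.

(** * Scalars and inner products *)

Section Scalars.
Variables (R : realType) (k : scalar_kind).
Local Notation K := (scalars R k).

Lemma scalar_conjB (a b : K) : scalar_conj (a - b) = scalar_conj a - scalar_conj b.
Proof. by move: a b; case: k => // a b /=; rewrite rmorphB. Qed.
Lemma scalar_conjD (a b : K) : scalar_conj (a + b) = scalar_conj a + scalar_conj b.
Proof. by move: a b; case: k => // a b /=; rewrite rmorphD. Qed.
Lemma scalar_conjM (a b : K) : scalar_conj (a * b) = scalar_conj a * scalar_conj b.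
Proof. by move: a b; case: k => // a b /=; rewrite rmorphM. Qed.
Lemma mul_scalar_conj (a : K) : a * scalar_conj a = `|a| ^+ 2.
Proof.
move: a; case: k => /= a; last by rewrite -normCK.
by rewrite real_normK ?num_real// expr2.
Qed.

(** Over the complex numbers the order is partial and is the real order on
    non-negative elements, so the completeness of the reals still gives infima
    of sets of non-negative scalars. *)
Lemma nneg_inf (A : set K) : A !=set0 -> (forall a, A a -> 0 <= a) ->
  exists d : K, [/\ 0 <= d, (forall a, A a -> d <= a) &
    forall e, 0 < e -> exists2 a, A a & a < d + e].
Proof.
move: A; case: k => /= A [a0 Aa0] A0.
- have hi : has_inf A by split; [exists a0|exists 0 => a /A0].
  exists (inf A); split.
  + by apply: lb_le_inf; [exists a0|move=> a /A0].
  + by move=> a Aa; apply: ge_inf => //; exists 0 => b /A0.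
  + by move=> e e0; have [a Aa lt] := @inf_adherent _ _ _ e0 hi; exists a.
- pose B : set R := [set r | A (r%:C)%C].
  have AB (a : R[i]) : A a -> B (complex.Re a) /\ a = ((complex.Re a)%:C)%C.
    move=> Aa; have := A0 _ Aa; case: a Aa => r s Aa.
    by rewrite lecE /= => /andP[/eqP ? _]; subst s.
  have B0 r : B r -> 0 <= r by move=> /A0; rewrite ler0c.
  have hi : has_inf B.
    split; first by exists (complex.Re a0); case: (AB _ Aa0).
    by exists 0 => r /B0.
  exists ((inf B)%:C)%C; split.
  + by rewrite ler0c; apply: lb_le_inf; [case: hi|move=> r /B0].
  + move=> a /AB[Ba ->]; rewrite lecR; apply: ge_inf => //.
    by exists 0 => r /B0.
  + move=> [e1 e2]; rewrite ltcE /= => /andP[/eqP -> e0].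
    have [r Br lt] := @inf_adherent _ _ _ e0 hi.
    by exists (r%:C)%C => //; rewrite ltcE /= addr0 eqxx.
Qed.

(** The infimum of the powers of 1/2 is invariant under halving, hence is 0. *)
Lemma archi_pow2 (e : K) : 0 < e -> exists n, 2 ^- n < e.
Proof.
move=> e0.
have [||d [d0 dlb dad]] := @nneg_inf [set 2 ^- n | n in setT].
- by exists 1; exists 0%N => //; rewrite expr0 invr1.
- by move=> _ [n _ <-]; rewrite invr_ge0 exprn_ge0.
have [d00|dn0] := eqVneq d 0.
  by have [_ [n _ <-]] := dad e e0; rewrite d00 add0r => h; exists n.
have dp : 0 < d by rewrite lt_def dn0.
have [_ [n _ <-]] := dad d dp; rewrite (_ : d + d = 2 * d); last by rewrite mulr_natl mulr2n.
move=> h.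
have : d <= 2 ^- n.+1 by apply: dlb; exists n.+1.
move=> /(lt_le_trans _) -/(_ (2 ^- n / 2)); rewrite ltr_pdivrMr//.
by rewrite exprSr invfM mulrC => /(_ h); rewrite ltxx.
Qed.

(** An unbundled form: definiteness and the laws in the second argument follow
    from these three, so restriction along an isometry is immediate. *)
Definition inner_product (H : normedModType K) (dot : H -> H -> K) : Prop :=
  [/\ forall a x y z, dot (a *: x + y) z = a * dot x z + dot y z,
      forall x y, dot y x = scalar_conj (dot x y) &
      forall x, dot x x = `|x| ^+ 2].

Lemma hilbert_inner_product (H : completeNormedModType K) :
  hilbert H <-> exists dot : H -> H -> K, inner_product dot.
Proof.
split=> [[dot nd]|[dot [dotP dotC dotn]]].
  exists dot; split=> [a x y z|x y|x //].
  - exact: linearPl.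
  - by rewrite (@hermitian_subproof _ _ _ _ dot) expr0 mul1r.
have dotBl z : {morph dot ^~ z : x y / x - y}.
  by move=> x y /=; rewrite addrC -scaleN1r dotP mulN1r addrC.
have dotZl z a x : dot (a *: x) z = a * dot x z.
  have d0 : dot 0 z = 0 by have := dotBl z 0 0; rewrite /= !subrr.
  by rewrite -[a *: x]addr0 dotP d0 addr0.
have dotBr z : {morph dot z : x y / x - y}.
  by move=> x y; rewrite dotC dotBl scalar_conjB -!dotC.
have dotZr z a x : dot z (a *: x) = scalar_conj a * dot z x.
  by rewrite dotC dotZl scalar_conjM -dotC.
pose m1 := isBilinear.Build K H H K *%R (@scalar_conj R k \; *%R) dot
  dotBl dotBr dotZl dotZr.
have h : forall x y, dot x y = (-1) ^+ false * scalar_conj (dot y x).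
  by move=> x y; rewrite expr0 mul1r.
have p : forall u : H, u != 0 -> 0 < dot u u.
  by move=> u u0; rewrite dotn exprn_gt0// normr_gt0.
pose d : {dot H for @scalar_conj R k} := HB.pack_for {dot H for @scalar_conj R k} dot m1
  (isHermitianSesquilinear.Build K H false (@scalar_conj R k) dot h)
  (isDotProduct.Build K H dot p).
by exists d => x; rewrite /= dotn.
Qed.
End Scalars.

(** * Orthogonal projection *)

Section Inner.
Variables (R : realType) (k : scalar_kind).
Local Notation K := (scalars R k).
Variables (H : completeNormedModType K) (dot : H -> H -> K).
Hypothesis hdot : inner_product dot.

Lemma dotPl a x y z : dot (a *: x + y) z = a * dot x z + dot y z.
Proof. by case: hdot. Qed.
Lemma dotC x y : dot y x = scalar_conj (dot x y).
Proof. by case: hdot. Qed.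
Lemma dotxx x : dot x x = `|x| ^+ 2.
Proof. by case: hdot. Qed.
Lemma dotDl z x y : dot (x + y) z = dot x z + dot y z.
Proof. by rewrite -[x]scale1r dotPl mul1r scale1r. Qed.
Lemma dot0l z : dot 0 z = 0.
Proof. by apply/(addrI (dot 0 z)); rewrite -dotDl !addr0. Qed.
Lemma dotZl z a x : dot (a *: x) z = a * dot x z.
Proof. by rewrite -[a *: x]addr0 dotPl dot0l addr0. Qed.
Lemma dotNl z x : dot (- x) z = - dot x z.
Proof. by rewrite -scaleN1r dotZl mulN1r. Qed.
Lemma dotBl z x y : dot (x - y) z = dot x z - dot y z.
Proof. by rewrite dotDl dotNl. Qed.
Lemma dotDr z x y : dot z (x + y) = dot z x + dot z y.
Proof. by rewrite dotC dotDl scalar_conjD -!dotC. Qed.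
Lemma dotBr z x y : dot z (x - y) = dot z x - dot z y.
Proof. by rewrite dotC dotBl scalar_conjB -!dotC. Qed.
Lemma dotZr z a x : dot z (a *: x) = scalar_conj a * dot z x.
Proof. by rewrite dotC dotZl scalar_conjM -dotC. Qed.
Lemma dot0r z : dot z 0 = 0.
Proof. by rewrite -(subrr (0 : H)) dotBr subrr. Qed.
Lemma dot_suml z n (F : 'I_n -> H) :
  dot (\sum_(i < n) F i) z = \sum_(i < n) dot (F i) z.
Proof.
elim: n F => [|n IH] F; first by rewrite !big_ord0 dot0l.
by rewrite !big_ord_recr /= dotDl IH.
Qed.
Lemma dot_eq0C x y : dot x y = 0 -> dot y x = 0.
Proof. by move=> h; rewrite dotC h -(dot0l 0) -dotC. Qed.

Lemma dotNr z x : dot z (- x) = - dot z x.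
Proof. by rewrite -sub0r dotBr dot0r sub0r. Qed.
Lemma dot_sumr z n (F : 'I_n -> H) :
  dot z (\sum_(i < n) F i) = \sum_(i < n) dot z (F i).
Proof.
elim: n F => [|n IH] F; first by rewrite !big_ord0 dot0r.
by rewrite !big_ord_recr /= dotDr IH.
Qed.

Lemma parallelogram (x y : H) :
  `|x + y| ^+ 2 + `|x - y| ^+ 2 = 2 * (`|x| ^+ 2 + `|y| ^+ 2).
Proof. rewrite -!dotxx !(dotDl, dotDr, dotNl, dotNr). ring. Qed.

Lemma pythagoras (x y : H) : dot x y = 0 ->
  `|x + y| ^+ 2 = `|x| ^+ 2 + `|y| ^+ 2.
Proof.
move=> h; rewrite -!dotxx !(dotDl, dotDr) h (dot_eq0C h); ring.
Qed.

(** Pythagoras for the orthogonal component of [x] along [y]; it yields both the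
    Cauchy-Schwarz inequality and the variational characterization of nearest
    points. *)
Lemma sqr_norm_sub_proj (x y : H) : y != 0 ->
  `|x - (dot x y / `|y| ^+ 2) *: y| ^+ 2 = `|x| ^+ 2 - `|dot x y| ^+ 2 / `|y| ^+ 2.
Proof.
move=> y0; set a := (X in X *: y).
have ny : `|y| ^+ 2 != 0 by rewrite sqrf_eq0 normr_eq0.
have h : dot (x - a *: y) (a *: y) = 0.
  by rewrite dotZr dotBl dotZl dotxx divfK// subrr mulr0.
have := pythagoras h; rewrite subrK => ->.
rewrite normrZ exprMn normrM normfV normrX normr_id.
set u := `|dot x y|; set n := `|y| ^+ 2 in ny *.
have -> : (u / n) ^+ 2 * n = u ^+ 2 / n.
  by rewrite [in LHS]expr2 -mulrA divfK// mulrAC -expr2.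
by rewrite addrK.
Qed.

Lemma cauchy_schwarz (x y : H) : `|dot x y| <= `|x| * `|y|.
Proof.
have [->|y0] := eqVneq y 0; first by rewrite dot0r !normr0 mulr0.
have := sqr_norm_sub_proj x y0 => h.
have : 0 <= `|x| ^+ 2 - `|dot x y| ^+ 2 / `|y| ^+ 2 by rewrite -h exprn_ge0.
have yp : 0 < `|y| by rewrite normr_gt0.
rewrite subr_ge0 ler_pdivrMr ?exprn_gt0// -exprMn.
by rewrite ler_pXn2r// nnegrE// mulr_ge0.
Qed.

Lemma dot_continuous (X : topologicalType) (f g : X -> H) :
  continuous f -> continuous g -> continuous (fun x => dot (f x) (g x)).
Proof.
move=> cf cg x; apply/(@cvgrPdist_lt K K^o) => e e0.
have fx1 : 0 < `|f x| + 1 by rewrite ltr_wpDl.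
have gx1 : 0 < `|g x| + 1 by rewrite ltr_wpDl.
have e1 : 0 < e / 2 / (`|g x| + 1) by rewrite !divr_gt0.
have e2 : 0 < e / 2 / (`|f x| + 1) by rewrite !divr_gt0.
near=> y.
have -> : dot (f x) (g x) - dot (f y) (g y)
  = dot (f x - f y) (g y) + dot (f x) (g x - g y).
  by rewrite dotBl dotBr; ring.
rewrite (le_lt_trans (ler_normD _ _))// [ltRHS]splitr ltrD//.
  apply: le_lt_trans (cauchy_schwarz _ _) _.
  apply: (@le_lt_trans _ _ (`|f x - f y| * (`|g x| + 1))).
    rewrite ler_wpM2l// -[X in `|X|](subKr (g x)).
    rewrite (le_trans (ler_normB _ _))// lerD2l ltW//; near: y.
    by have /cvgrPdist_lt := cg x; apply.
  rewrite -ltr_pdivlMr//; near: y.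
  by have /cvgrPdist_lt := cf x; apply.
apply: le_lt_trans (cauchy_schwarz _ _) _.
apply: (@le_lt_trans _ _ ((`|f x| + 1) * `|g x - g y|)).
  by rewrite ler_wpM2r// lerDl.
rewrite -ltr_pdivlMl// mulrC; near: y.
by have /cvgrPdist_lt := cg x; apply.
Unshelve. all: by end_near. Qed.

Definition orthogonal_to (M : set H) (x : H) : Prop :=
  forall z, M z -> dot x z = 0.

(** By the parallelogram law, points of [M] that nearly realize the distance
    from [x] are close to each other, so the almost minimizing sets generate a
    Cauchy filter; its limit is the nearest point. *)
Lemma nearest_point (M : set H) (x : H) :
  linear_subspace M -> closed M -> exists2 m, M m &
  forall z, M z -> `|x - m| <= `|x - z|.
Proof.
move=> [M0 MP] Mc.
have [||d [d0 dlb dad]] := @nneg_inf R k [set `|x - m| ^+ 2 | m in M].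
- by exists (`|x - 0| ^+ 2), 0.
- by move=> _ [m _ <-]; rewrite exprn_ge0.
pose A e := [set m | M m /\ `|x - m| ^+ 2 < d + e].
have A0 e : 0 < e -> A e !=set0.
  by move=> /dad[_ [m Mm <-]] h; exists m.
pose F : set_system H := filter_from [set e : K | 0 < e] A.
have FF : ProperFilter F.
  apply: filter_from_proper; last by move=> e /A0.
  apply: filter_from_filter; first by exists 1 => /=.
  move=> e f e0 f0.
  case: (real_leP (gtr0_real e0) (gtr0_real f0)) => ef; [exists e|exists f] => //;
    by move=> m [Mm hm]; split; split=> //; apply: (lt_le_trans hm);
    rewrite lerD2l// ltW.
have close e m m' : A e m -> A e m' -> `|m - m'| ^+ 2 <= 4 * e.
  move=> [Mm hm] [Mm' hm'].
  (* The midpoint lies in [M], so its distance to [x] is bounded below. *)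
  have hmid : d <= `|x - 2^-1 *: (m + m')| ^+ 2.
    apply: dlb; exists (2^-1 *: (m + m')) => //.
    have mm : M (m + m') by rewrite -[m]scale1r; exact: MP.
    by rewrite -[_ *: _]addr0; exact: MP.
  have := parallelogram (x - m) (x - m').
  have -> : x - m + (x - m') = 2 *: (x - 2^-1 *: (m + m')).
    rewrite scalerBr scalerA mulfV ?pnatr_eq0//. rewrite scale1r scaler_nat mulr2n.
    by rewrite opprD addrACA.
  have -> : x - m - (x - m') = m' - m by rewrite opprB addrC subrKA.
  rewrite (distrC m') normrZ exprMn normr_nat => h.
  have -> : `|m - m'| ^+ 2 = 2 * (`|x - m| ^+ 2 + `|x - m'| ^+ 2)
     - 2 ^+ 2 * `|x - 2^-1 *: (m + m')| ^+ 2.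
    by apply/eqP; rewrite eq_sym subr_eq -h addrC.
  rewrite lerBlDr (@le_trans _ _ (2 * ((d + e) + (d + e))))//.
    by rewrite ler_wpM2l// lerD// ltW.
  rewrite [leLHS](_ : _ = 4 * e + 2 ^+ 2 * d); last by ring.
  by rewrite lerD2l ler_wpM2l// exprn_ge0.
have cF : cauchy F.
  apply/cauchy_exP => e e0.
  have e1 : 0 < e ^+ 2 / 8 by rewrite divr_gt0// exprn_gt0.
  have [m Am] := A0 _ e1; exists m; exists (e ^+ 2 / 8) => // m' Am'.
  rewrite -ball_normE /ball_/= -(@ltr_pXn2r _ 2)// ?nnegrE//; last exact: ltW.
  apply: le_lt_trans (close _ _ _ Am Am') _.
  rewrite mulrC -mulrA gtr_pMr ?exprn_gt0// mulrC ltr_pdivrMr// mul1r.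
  by rewrite ltr_nat.
have [m Fm] := (cvg_ex F).1 (cauchy_cvg F cF).
have Mm : M m.
  apply: (@closed_cvg _ _ F _ id M Mc _ _ Fm).
  by exists 1 => [|z []//] /=.
exists m => // z Mz; rewrite real_leNgt ?normr_real//; apply/negP => lt.
(* [e'] is chosen so that the members of [A e'] are at distance less than
   [`|x - z| + e] from [x]. *)
pose e := (`|x - m| - `|x - z|) / 2.
have e0 : 0 < e by rewrite divr_gt0// subr_gt0.
pose e' := (`|x - z| + e) ^+ 2 - `|x - z| ^+ 2.
have e'0 : 0 < e'.
  by rewrite subr_gt0 ltr_pXn2r// ?nnegrE ?addr_ge0 ?ltrDl// ltW.
have : F (ball m e `&` A e').
  by apply: filterI; [apply: Fm; exact: nbhsx_ballx|exists e'].
move=> /filter_ex[w [] + [Mw hw]]; rewrite -ball_normE /ball_/= => mw.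
have : `|x - w| < `|x - z| + e.
  rewrite -(@ltr_pXn2r _ 2)// ?nnegrE ?addr_ge0//; last exact: ltW.
  rewrite (lt_le_trans hw)// -lerBrDr /e' opprB addrC subrK.
  by apply: dlb; exists z.
move=> xw; have : `|x - m| < `|x - m|.
  rewrite [ltRHS](_ : _ = `|x - z| + e + e); last first.
    by rewrite -addrA -splitr addrC subrK.
  rewrite -[x - m](subrKA w) (le_lt_trans (ler_normD _ _))// ltrD//.
  by rewrite distrC.
by rewrite ltxx.
Qed.

Lemma linear_subspaceB (M : set H) x y : linear_subspace M ->
  M x -> M y -> M (x - y).
Proof. by move=> [_ MP] Mx My; rewrite addrC -scaleN1r; exact: MP. Qed.

Lemma linear_subspaceZ (M : set H) a x : linear_subspace M ->
  M x -> M (a *: x).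
Proof. by move=> [M0 MP] Mx; rewrite -[_ *: x]addr0; exact: MP. Qed.

Lemma linear_subspaceD (M : set H) x y : linear_subspace M ->
  M x -> M y -> M (x + y).
Proof. by move=> [_ MP] Mx My; rewrite -[x]scale1r; exact: MP. Qed.

Lemma orthogonal_self (M : set H) x : M x -> orthogonal_to M x -> x = 0.
Proof.
move=> Mx /(_ _ Mx)/eqP; rewrite dotxx sqrf_eq0 normr_eq0 => /eqP//.
Qed.

(** Otherwise moving [m] along [z] would decrease the distance to [x]. *)
Lemma nearest_orthogonal (M : set H) (x m : H) : linear_subspace M -> M m ->
  (forall z, M z -> `|x - m| <= `|x - z|) -> orthogonal_to M (x - m).
Proof.
move=> Ms Mm hm z Mz; have [->|z0] := eqVneq z 0; first by rewrite dot0r.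
have := sqr_norm_sub_proj (x - m) z0.
set a := (X in X *: z) => h.
have : `|x - m| <= `|x - m - a *: z|.
  rewrite -addrA -opprD; apply: hm; apply: linear_subspaceD => //.
  exact: linear_subspaceZ.
rewrite -(@ler_pXn2r _ 2)// ?nnegrE// h lerBrDl gerDr.
rewrite pmulr_lle0 ?invr_gt0 ?exprn_gt0 ?normr_gt0//.
move=> h0; have : `|dot (x - m) z| ^+ 2 == 0 by rewrite eq_le h0 exprn_ge0.
by rewrite sqrf_eq0 normr_eq0 => /eqP.
Qed.

(** [Q] is the orthogonal projection along [M], onto the complement of [M]; its
    linearity follows from the uniqueness of the decomposition. *)
Lemma orthogonal_projection (M : set H) : linear_subspace M -> closed M ->
  exists Q : {linear H -> H},
  [/\ forall x, M (x - Q x), forall x, orthogonal_to M (Q x) &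
      forall x, `|Q x| <= `|x|].
Proof.
move=> Ms Mc.
have /choice[q hq] : forall x, exists q, M (x - q) /\ orthogonal_to M q.
  move=> x; have [m Mm hm] := nearest_point x Ms Mc.
  exists (x - m); split; first by rewrite subKr.
  exact: nearest_orthogonal.
have ql : linear q.
  move=> a x y; apply/eqP; rewrite -subr_eq0; apply/eqP.
  have [hx1 hx2] := hq x; have [hy1 hy2] := hq y.
  have [h1 h2] := hq (a *: x + y).
  apply: (@orthogonal_self M).
    rewrite [X in M X](_ : _ = (a *: (x - q x) + (y - q y))
       - (a *: x + y - q (a *: x + y))).
      by apply: linear_subspaceB => //; case: Ms => _; exact.
    by rewrite scalerBr [in RHS]addrACA -opprD opprB [RHS]addrC addrA subrK.
  by move=> z Mz; rewrite dotBl dotPl hx2// hy2// h2// mulr0 addr0 subrr.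
pose Q : {linear H -> H} :=
  HB.pack_for {linear H -> H} q (GRing.isLinear.Build K H H *:%R q ql).
exists Q; split=> x; [exact: (hq x).1|exact: (hq x).2|].
have h : dot (x - q x) (q x) = 0 by apply: dot_eq0C; exact: (hq x).2 (hq x).1.
have := pythagoras h; rewrite subrK => e.
by rewrite -(@ler_pXn2r _ 2)// ?nnegrE// e lerDr exprn_ge0.
Qed.

Lemma orthogonal_to_subspace (M : set H) : linear_subspace (orthogonal_to M).
Proof.
split=> [z _|a x y hx hy z Mz]; first by rewrite dot0l.
by rewrite dotPl hx// hy// mulr0 addr0.
Qed.

Lemma orthogonal_to_closed (M : set H) : closed (orthogonal_to M).
Proof.
rewrite (_ : orthogonal_to M = \bigcap_(z in M) (dot ^~ z) @^-1` [set 0]).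
  apply: closed_bigI => z Mz; apply: closed_comp.
    by move=> x _; apply: dot_continuous => // ?; [exact: cvg_id|exact: cvg_cst].
  apply: accessible_closed_set1; apply: hausdorff_accessible.
  exact: norm_hausdorff.
by apply/seteqP; split=> x h z Mz; exact: h.
Qed.
End Inner.

(** * Closed subspaces as complete spaces *)

Section Subspace.
Variables (K : numFieldType) (H : completeNormedModType K).

(** The proofs are packed with the set so that the carrier type of the subspace
    depends on a single term, on which the algebraic and topological structures
    can be inferred. *)
Record closed_subspace := ClosedSubspace {
  carrier : set H;
  carrier_subspace : linear_subspace carrier;
  carrier_closed : closed carrier }.

Definition in_subspace (L : closed_subspace) : {pred H} :=
  fun x => `[< carrier L x >].

Fact in_subspace_submod_closed (L : closed_subspace) :
  submod_closed (in_subspace L).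
Proof.
have [L0 LP] := carrier_subspace L.
split=> [|a x y /asboolP Lx /asboolP Ly]; apply/asboolP => //; exact: LP.
Qed.

HB.instance Definition _ (L : closed_subspace) :=
  GRing.isSubmodClosed.Build K H (in_subspace L) (in_subspace_submod_closed L).

Record subspace_type (L : closed_subspace) := SubspaceElt {
  elt :> H; _ : in_subspace L elt }.

HB.instance Definition _ (L : closed_subspace) := [isSub for @elt L].
HB.instance Definition _ (L : closed_subspace) :=
  [Choice of subspace_type L by <:].
HB.instance Definition _ (L : closed_subspace) :=
  [SubChoice_isSubLmodule of subspace_type L by <:].

Section Norm.
Variable L : closed_subspace.
Local Notation E := (subspace_type L).

Definition subspace_norm (x : E) : K := `|elt x|.
Fact subspace_normD x y : subspace_norm (x + y) <= subspace_norm x + subspace_norm y.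
Proof. exact: ler_normD. Qed.
Fact subspace_normZ a x : subspace_norm (a *: x) = `|a| * subspace_norm x.
Proof. exact: normrZ. Qed.
Fact subspace_norm0_eq0 x : subspace_norm x = 0 -> x = 0.
Proof. by move=> /normr0_eq0 h; apply/val_inj. Qed.

HB.instance Definition _ := Lmodule_isNormed.Build K E
  subspace_normD subspace_normZ subspace_norm0_eq0.

Lemma elt_is_linear : linear (@elt L : E -> H).
Proof. by []. Qed.
HB.instance Definition _ := GRing.isLinear.Build K E H *:%R (@elt L) elt_is_linear.

Fact subspace_cauchy_cvg (F : set_system E) :
  ProperFilter F -> cauchy F -> cvg F.
Proof.
move=> FF cF.
have cG : cauchy (@elt L @ F).
  apply/cauchy_exP => e e0.
  have [x Fx] := (cauchyP F).1 cF e e0.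
  exists (elt x); rewrite /= /nbhs/=; apply: filterS Fx => y.
  by rewrite -!ball_normE.
have [l hl] := (cvg_ex (@elt L @ F)).1 (cauchy_cvg (@elt L @ F) cG).
have Ll : carrier L l.
  have nF : \forall y \near F, carrier L (elt y).
    by apply: nearW => -[y /= /asboolP].
  exact: (@closed_cvg _ _ F _ (@elt L) (carrier L) (@carrier_closed L) nF l hl).
have Ll' : in_subspace L l by apply/asboolP.
apply/cvg_ex; exists (SubspaceElt Ll').
apply/fcvgrPdist_lt => e e0.
by have /cvgrPdist_lt/(_ e e0) := hl.
Qed.

HB.instance Definition _ := Uniform_isComplete.Build E subspace_cauchy_cvg.
End Norm.

(** Presents a closed subspace as the range of an isometry from a complete space,
    which hides the subtype in the sequel. *)
Lemma subspace_complete_space (L : set H) : linear_subspace L -> closed L ->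
  exists (E : completeNormedModType K) (i : {linear E -> H}),
    (forall e, `|i e| = `|e|) /\ range i = L.
Proof.
move=> Ls Lc; pose S := ClosedSubspace Ls Lc.
exists (subspace_type S), (@elt S); split=> //.
apply/seteqP; split=> [_ [[x /= /asboolP hx] _ <-] //|x Lx].
have hx : in_subspace S x by apply/asboolP.
by exists (SubspaceElt hx).
Qed.
End Subspace.

(** * Dense orbits in finite dimension *)

(** Solve the relation for the last vector whose coefficient is non-zero. *)
Lemma dependent_on_predecessors (K : numFieldType) (V : lmodType K) (v : nat -> V) n
    (u : 'rV[K]_n) : u != 0 -> \sum_(i < n) u 0 i *: v i = 0 ->
  exists2 d, (d < n)%N & exists c : nat -> K, v d = \sum_(i < d) c i *: v i.
Proof.
elim: n u => [|n IH] u; first by rewrite (thinmx0 u) eqxx.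
rewrite big_ord_recr/= => u0 rel.
have [un|un] := eqVneq (u 0 ord_max) 0.
  pose u' : 'rV[K]_n := \row_i u 0 (widen_ord (leqnSn n) i).
  have [||d dn hd] := IH u'; last by exists d => //; exact: ltnW.
    apply: contra_neq u0 => u'0; apply/rowP => i; rewrite mxE.
    case: (unliftP ord_max i) => [j ->|-> //].
    have /rowP/(_ j) := u'0; rewrite !mxE => <-; congr (u 0 _).
    by apply/val_inj => /=; rewrite /bump leqNgt ltn_ord.
  move: rel; rewrite un scale0r addr0 => rel; rewrite -[RHS]rel.
  by apply: eq_bigr => i _; rewrite mxE.
exists n => //; exists (fun i => - (u 0 ord_max)^-1 * u 0 (inord i)).
under eq_bigr do rewrite -scalerA.
rewrite -scaler_sumr scaleNr -scalerN.
move/eqP: rel; rewrite addrC addr_eq0 => /eqP rel.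
rewrite (eq_bigr (fun i => u 0 (widen_ord (leqnSn n) i) *: v i)); last first.
  move=> i _; congr (u 0 _ *: _); apply/val_inj => /=.
  by rewrite inordK// ltnS ltnW.
by rewrite -rel scalerA mulVf// scale1r.
Qed.

Lemma finite_dimensional_dependent (K : numFieldType) (V : lmodType K)
    (v : nat -> V) : finite_dimensional V ->
  exists d, exists c : nat -> K, v d = \sum_(i < d) c i *: v i.
Proof.
move=> [n [e he]].
have /choice[c hc] : forall i, exists c : 'I_n -> K, v i = \sum_(j < n) c j *: e j.
  by move=> i; exact: he.
pose A : 'M[K]_(n.+1, n) := \matrix_(i, j) c i j.
have : ~~ row_free A.
  by rewrite -row_leq_rank -ltnNge ltnS rank_leq_col.
rewrite -kermx_eq0 => /rowV0Pn[u /sub_kermxP uA u0].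
have [|d _ hd] := dependent_on_predecessors (v := v) u0; last by exists d.
under eq_bigr => i _ do rewrite hc scaler_sumr.
rewrite exchange_big big1//= => j _.
under eq_bigr do rewrite scalerA.
rewrite -scaler_suml; have /matrixP/(_ 0 j) := uA; rewrite !mxE => uAj.
rewrite (eq_bigr (fun i => u 0 i * A i j)) ?uAj ?scale0r//.
by move=> i _; rewrite mxE.
Qed.

Section Krylov.
Variables (R : realType) (k : scalar_kind).
Local Notation K := (scalars R k).
Variables (H : completeNormedModType K) (dot : H -> H -> K).
Hypothesis hdot : inner_product dot.
Variable T : {linear H -> H}.
Hypothesis Tc : continuous T.

(** Gram matrix of the Krylov family [x, T x, ..., T^(d-1) x]. *)
Definition krylov_gram d (x : H) : 'M[K]_d :=
  \matrix_(i, j) dot (iter i T x) (iter j T x).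

Lemma iterZ n a x : iter n T (a *: x) = a *: iter n T x.
Proof. by elim: n => //= n ->; rewrite linearZ. Qed.

Lemma iter_sum n m (c : 'I_m -> K) (x : 'I_m -> H) :
  iter n T (\sum_(i < m) c i *: x i) = \sum_(i < m) c i *: iter n T (x i).
Proof.
elim: n => //= n ->; rewrite linear_sum.
by apply: eq_bigr => i _; rewrite linearZ.
Qed.

Lemma iter_continuous n : continuous (iter n T).
Proof.
elim: n => [|n IH] x /=; first exact: cvg_id.
by apply: continuous_comp; [exact: IH|exact: Tc].
Qed.

Lemma continuous_sum (I : Type) (r : seq I) (f : I -> H -> K) :
  (forall i, continuous (f i)) -> continuous (fun x => \sum_(i <- r) f i x).
Proof.
move=> cf; elim: r => [|i r IH] x.
  under eq_fun do rewrite big_nil; exact: cvg_cst.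
under eq_fun do rewrite big_cons.
apply: cvgD; [exact: cf|exact: IH].
Qed.
Lemma continuous_prod (I : Type) (r : seq I) (f : I -> H -> K) :
  (forall i, continuous (f i)) -> continuous (fun x => \prod_(i <- r) f i x).
Proof.
move=> cf; elim: r => [|i r IH] x.
  under eq_fun do rewrite big_nil; exact: cvg_cst.
under eq_fun do rewrite big_cons.
apply: cvgM; [exact: cf|exact: IH].
Qed.

Lemma det_krylov_gram_continuous d : continuous (fun x => \det (krylov_gram d x)).
Proof.
rewrite /determinant; apply: continuous_sum => s.
move=> x; apply: (@continuousM _ _ (cst _)); first exact: cvg_cst.
apply: continuous_prod => i y.
rewrite /krylov_gram; under eq_fun do rewrite mxE.
by apply: (dot_continuous hdot); exact: iter_continuous.
Qed.

Lemma det_krylov_gramZ d a x :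
  `|\det (krylov_gram d (a *: x))| = (`|a| ^+ 2) ^+ d * `|\det (krylov_gram d x)|.
Proof.
rewrite (_ : krylov_gram d _ = (a * scalar_conj a) *: krylov_gram d x).
  by rewrite detZ normrM normrX mul_scalar_conj normrX normr_id.
by apply/matrixP => i j; rewrite !mxE !iterZ (dotZl hdot) (dotZr hdot) mulrA.
Qed.

(** Once [T^d y] depends on the earlier iterates, the Krylov family of [T x] is
    the image of that of [x] under one fixed matrix, for every [x] in the
    orbit of [y]; its Gram determinant is thus multiplied by a constant. *)
Lemma det_krylov_gram_step d y (c : nat -> K) :
  iter d T y = \sum_(i < d) c i *: iter i T y ->
  exists2 delta : K, 0 <= delta & forall n,
   `|\det (krylov_gram d (iter n T y))| = delta ^+ n * `|\det (krylov_gram d y)|.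
Proof.
move=> hc.
have /choice[C hC] : forall i : 'I_d, exists C : 'I_d -> K,
    iter i.+1 T y = \sum_(j < d) C j *: iter j T y.
  move=> i; have [id|id] := ltnP i.+1 d.
    exists (fun j => (j == Ordinal id)%:R).
    rewrite (bigD1 (Ordinal id))//= eqxx scale1r big1 ?addr0// => j /negPf ->.
    by rewrite scale0r.
  exists (fun j => c j); rewrite -hc; congr (iter _ T y).
  by apply/eqP; rewrite eqn_leq id ltn_ord.
pose M : 'M[K]_d := \matrix_(i, j) C i j.
pose M' : 'M[K]_d := \matrix_(i, j) scalar_conj (C j i).
have step n : krylov_gram d (iter n.+1 T y) =
    M *m krylov_gram d (iter n T y) *m M'.
  have hC' (i : 'I_d) : iter i T (iter n.+1 T y) =
      \sum_(j < d) C i j *: iter j T (iter n T y).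
    rewrite -iterD addnS -addSn addnC iterD hC iter_sum.
    by apply: eq_bigr => j _; rewrite -!iterD addnC.
  apply/matrixP => i j; rewrite !mxE !hC' (dot_suml hdot).
  rewrite [RHS](eq_bigr (fun l => \sum_(m < d) C i m * (krylov_gram d (iter n T y) m l
     * scalar_conj (C j l)))); last first.
    by move=> l _; rewrite !mxE mulr_suml; apply: eq_bigr => m _; rewrite !mxE mulrA.
  rewrite exchange_big; apply: eq_bigr => m _ /=.
  rewrite (dotZl hdot) -mulr_sumr; congr (_ * _).
  rewrite (dot_sumr hdot); apply: eq_bigr => l _.
  by rewrite (dotZr hdot) mxE mulrC.
exists (`|\det M| * `|\det M'|) => [|n]; first exact: mulr_ge0.
elim: n => [|n IH]; first by rewrite expr0 mul1r.
rewrite step !det_mulmx !normrM IH exprS; ring.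
Qed.

(** A left kernel vector of the Gram matrix gives a combination of the Krylov
    vectors that is orthogonal to all of them, hence to itself. *)
Lemma det_krylov_gram_neq0 d y :
  (forall m (c : nat -> K), (m < d)%N ->
     iter m T y <> \sum_(i < m) c i *: iter i T y) ->
  \det (krylov_gram d y) != 0.
Proof.
move=> indep; apply/negP => /det0P[u u0 /matrixP uG].
suff : \sum_(i < d) u 0 i *: iter i T y = 0.
  by move=> /(dependent_on_predecessors (v := fun n => iter n T y) u0)[m md [c /indep]]; exact.
set x := LHS.
have hx (j : 'I_d) : dot x (iter j T y) = 0.
  have := uG 0 j; rewrite !mxE => <-; rewrite (dot_suml hdot).
  by apply: eq_bigr => i _; rewrite mxE (dotZl hdot).
apply/eqP; rewrite -normr_eq0 -sqrf_eq0 -(dotxx hdot) {2}/x (dot_sumr hdot).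
by apply/eqP/big1 => j _; rewrite (dotZr hdot) hx mulr0.
Qed.

(** In finite dimension, take the least [d] for which [T^d y] depends on the
    earlier iterates. Along the orbit, the modulus of the Gram determinant is
    [delta ^+ n * g] with [g] positive. By density and continuity it comes close
    to its values at [2 *: y] and at [0 *: y], which are at least [2 * g] and
    equal to 0: the first excludes [delta <= 1], the second [1 < delta]. *)
Lemma dense_orbit_infinite_dimensional y : y != 0 ->
  orb_closure T y = setT -> infinite_dimensional H.
Proof.
move=> y0 dense fd.
have := finite_dimensional_dependent (fun n => iter n T y) fd.
pose P d := `[< exists c : nat -> K, iter d T y = \sum_(i < d) c i *: iter i T y >].
move=> [d0 hd0]; have exP : exists d, P d by exists d0; apply/asboolP.
have [d /asboolP[c hc] dmin] := ex_minnP exP.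
have dpos : (0 < d)%N.
  by case: d hc {dmin} => // /eqP; rewrite big_ord0/= (negPf y0).
have G0 : \det (krylov_gram d y) != 0.
  apply: det_krylov_gram_neq0 => m c' md hm.
  have : P m by apply/asboolP; exists c'.
  by move=> /dmin; rewrite leqNgt md.
set g := `|\det (krylov_gram d y)|.
have g0 : 0 < g by rewrite normr_gt0.
have [delta delta0 hdelta] := det_krylov_gram_step hc.
have approx (a e : K) : 0 < e -> exists n, `|(`|a| ^+ 2) ^+ d - delta ^+ n| < e.
  move=> e0.
  have : orb_closure T y (a *: y) by rewrite dense.
  have := @det_krylov_gram_continuous d (a *: y).
  move=> /(@cvgrPdist_lt K K^o)/(_ (e * g))/(_ (mulr_gt0 e0 g0)) nb cl.
  have [_ [[n _ <-] /= hn]] := cl _ nb.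
  exists n; rewrite -(ltr_pM2r g0) -[X in _ * X](gtr0_norm g0) -normrM mulrBl.
  rewrite /g -det_krylov_gramZ -hdelta.
  by apply: le_lt_trans hn; rewrite ler_dist_dist.
have [d1|d1] := real_leP (ger0_real delta0) (@real1 K).
- have [n] := approx 2 1 ltr01.
  have dn1 : delta ^+ n <= 1 by rewrite exprn_ile1.
  have d2 : 2 <= (`|2| ^+ 2) ^+ d :> K.
    rewrite normr_nat -exprM -[leLHS]expr1 ler_weXn2l ?ler1n//.
    by rewrite muln_gt0.
  have dr : (`|2| ^+ 2) ^+ d - delta ^+ n \is Num.real.
    by rewrite realB// ger0_real// ?exprn_ge0.
  move=> /(le_lt_trans (real_ler_norm dr)); rewrite ltrBlDr => lt.
  have : 2 < 2 :> K.
    by rewrite (le_lt_trans d2)// (lt_le_trans lt)// -[leRHS]/(1 + 1) lerD2l.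
  by rewrite ltxx.
- have [n] := approx 0 1 ltr01.
  rewrite normr0 expr0n expr0n -leqn0 leqNgt dpos sub0r normrN.
  rewrite ger0_norm ?exprn_ge0// => lt.
  have : 1 <= delta ^+ n by rewrite exprn_ege1// ltW.
  by move=> /(lt_le_trans lt); rewrite ltxx.
Qed.
End Krylov.

(** * Compression and density of the chain of orbit closures *)

Section Orbits.
Variables (K : numFieldType) (H : normedModType K) (T : {linear H -> H}).

Lemma bounded_operator_continuous : bounded_operator T -> continuous T.
Proof.
move=> [C hC]; apply: bounded_linear_continuous; apply/bounded_funP => r.
exists (`|C| * `|r|) => x xr; apply: le_trans (hC x) _.
have [->|x0] := eqVneq x 0; first by rewrite normr0 mulr0 mulr_ge0.
have xp : 0 < `|x| by rewrite normr_gt0.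
have r0 : 0 <= r by exact: le_trans xr.
have C0 : 0 <= C.
  by rewrite -(pmulr_lge0 _ xp); apply: le_trans (hC x).
by rewrite !ger0_norm// ler_wpM2l.
Qed.

Hypothesis Tc : continuous T.

Lemma orb_closure_self x : orb_closure T x x.
Proof. by apply: subset_closure; exists 0%N. Qed.

Lemma orb_closure_closed x : closed (orb_closure T x).
Proof. exact: closed_closure. Qed.

Lemma invariant_orb_closure (F : set H) x :
  closed F -> (forall z, F z -> F (T z)) -> F x -> orb_closure T x `<=` F.
Proof.
move=> Fc FT Fx; rewrite [X in _ `<=` X](closure_id F).1//.
apply: closure_subset => _ [n _ <-].
by elim: n => //= n; exact: FT.
Qed.

Lemma orb_closure_invariant x z : orb_closure T x z -> orb_closure T x (T z).
Proof.
move=> xz B /Tc /xz[_ [[n _ <-] /= Bz]].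
by exists (T (iter n T x)); split => //; exists n.+1.
Qed.

Lemma orb_closure_min x z : orb_closure T x z ->
  orb_closure T z `<=` orb_closure T x.
Proof.
apply: invariant_orb_closure; first exact: orb_closure_closed.
by move=> ?; exact: orb_closure_invariant.
Qed.

End Orbits.

Section Hilbert.
Variables (R : realType) (k : scalar_kind).
Local Notation K := (scalars R k).
Variables (H : completeNormedModType K) (dot : H -> H -> K).
Hypothesis hdot : inner_product dot.

Lemma isometry_inner_product (E : completeNormedModType K) (i : {linear E -> H}) :
  (forall e, `|i e| = `|e|) -> inner_product (fun e f => dot (i e) (i f)).
Proof.
move=> hi; split=> [a x y z|x y|x].
- by rewrite linearP (dotPl hdot).
- exact: dotC.
- by rewrite (dotxx hdot) hi.
Qed.

Lemma isometry_inj (E : completeNormedModType K) (i : {linear E -> H}) :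
  (forall e, `|i e| = `|e|) -> injective i.
Proof.
move=> hi x y xy; apply/eqP; rewrite -subr_eq0 -normr_eq0 -hi linearB xy subrr.
by rewrite normr0.
Qed.

(** The orthogonal projection maps a countable dense set onto a countable dense
    subset of the range. *)
Lemma isometry_separable (E : completeNormedModType K) (i : {linear E -> H}) :
  (forall e, `|i e| = `|e|) -> linear_subspace (range i) -> closed (range i) ->
  separable_space H -> separable_space E.
Proof.
move=> hi Ls Lc [D [Dc Dd]].
have [Q [QM Qo Qn]] := orthogonal_projection hdot Ls Lc.
have /choice[j hj] : forall w, exists e, i e = w - Q w.
  by move=> w; have [e _ he] := QM w; exists e.
exists (j @` D); split; first exact: sub_countable (card_image_le _ _) Dc.
have jc : continuous j.
  move=> w; apply/cvgrPdist_lt => e e0.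
  have e20 : 0 < e / 2 by rewrite divr_gt0.
  have nb := nbhsx_ballx w _ e20; rewrite -ball_normE in nb.
  near=> w'.
  have -> : `|j w - j w'| = `|(w - w') - Q (w - w')|.
    by rewrite -hi (linearB i) !hj (linearB Q) !opprD addrACA.
  have ww' : `|w - w'| < e / 2 by near: w'; exact: nb.
  rewrite (le_lt_trans (ler_normB _ _))// [ltRHS]splitr ltrD//.
  by rewrite (le_lt_trans (Qn _)).
move=> O [e Oe] Oo.
have [|w [Ow Dw]] := Dd (j @^-1` O) _ (open_comp (fun x _ => jc x) Oo).
  exists (i e) => /=; rewrite (_ : j (i e) = e)//.
  apply: (isometry_inj hi); rewrite hj.
  rewrite (_ : Q (i e) = 0) ?subr0//.
  apply: (orthogonal_self hdot (M := range i)); last exact: Qo.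
  have ie : range i (i e) by exists e.
  rewrite -(subKr (i e) (Q (i e))).
  exact: linear_subspaceB.
by exists (j w); split => //; exists w.
Unshelve. all: by end_near. Qed.

Variable T : {linear H -> H}.
Hypothesis Tb : bounded_operator T.
Hypothesis Ts : forall x, linear_subspace (orb_closure T x).
Hypothesis Tu : orbit_unicellular T.
Local Notation M := (orb_closure T).
Let Tc : continuous T := bounded_operator_continuous Tb.

(** [A] is the compression of [T] to the orthogonal complement of [M x] in [M y].
    Since [M x] is invariant, projecting away from it intertwines the iterates of
    [T] with those of [A], so orbits that are dense in [M y] project onto dense
    orbits. *)
Lemma compression_dense_orbits x y : ~ M y `<=` M x -> M x `<=` M y ->
  (forall z, M z `<=` M y -> M z `<=` M x \/ M y `<=` M z) ->
  exists (E : completeNormedModType K) (i : {linear E -> H}) (A : {linear E -> E}),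
  [/\ (forall e, `|i e| = `|e|), linear_subspace (range i) /\ closed (range i),
     bounded_operator A, (exists e : E, e != 0) &
      forall e, e != 0 -> orb_closure A e = setT].
Proof.
move=> nyx xy gap.
pose L := M y `&` orthogonal_to dot (M x).
have Ls : linear_subspace L.
  have [y0 yP] := Ts y; have [x0 xP] := orthogonal_to_subspace hdot (M x).
  by split=> // a u v [? ?] [? ?]; split; [exact: yP|exact: xP].
have Lc : closed L.
  by apply: closedI; [exact: orb_closure_closed|exact: orthogonal_to_closed].
have [E [i [hi iL]]] := subspace_complete_space Ls Lc.
have [Q [QM Qo Qn]] := orthogonal_projection hdot (Ts x) (@orb_closure_closed _ _ T x).
have iLe e : L (i e) by rewrite -iL; exists e.
have Qy w : M y w -> L (Q w).
  move=> yw; split; last exact: Qo.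
  rewrite -(subKr w (Q w)).
  by apply: (linear_subspaceB (Ts y)) => //; apply: xy; exact: QM.
have Q0 w : M x w -> Q w = 0.
  move=> xw; apply: (orthogonal_self hdot (M := M x)); last exact: Qo.
  rewrite -(subKr w (Q w)).
  by apply: (linear_subspaceB (Ts x)) => //; exact: QM.
have Qid w : orthogonal_to dot (M x) w -> Q w = w.
  move=> wo; apply/eqP; rewrite eq_sym -subr_eq0; apply/eqP.
  apply: (orthogonal_self hdot (QM w)) => z xz.
  by rewrite (dotBl hdot) wo// Qo// subrr.
(* [M x] is invariant and [Q] vanishes on it, so the component of [w] in [M x]
   has no effect on [Q (T w)]. *)
have QTQ w : Q (T (Q w)) = Q (T w).
  apply/eqP; rewrite eq_sym -subr_eq0 -!linearB; apply/eqP.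
  by apply: Q0; apply: (orb_closure_invariant Tc); exact: QM.
have /choice[A hA] : forall e, exists f, i f = Q (T (i e)).
  move=> e; have [ye _] := iLe e.
  have : L (Q (T (i e))) by apply: Qy; exact: (orb_closure_invariant Tc).
  by rewrite -{1}iL => -[f _ <-]; exists f.
have Al : linear A.
  by move=> a u v; apply: (isometry_inj hi); rewrite hA !linearP !hA.
pose A' : {linear E -> E} :=
  HB.pack_for {linear E -> E} A (GRing.isLinear.Build K E E *:%R A Al).
exists E, i, A'; split=> //; first by rewrite iL.
- have [C hC] := Tb; exists C => e.
  by rewrite -hi /= hA (le_trans (Qn _))// (le_trans (hC _))// hi.
- have := Qy y (@orb_closure_self _ _ T y).
  rewrite -{1}iL => -[e _ he]; exists e; apply: contra_notN nyx => /eqP e0.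
  apply: (orb_closure_min Tc).
  have := QM y; rewrite -he e0 linear0 subr0//.
move=> e e0.
have iter_A n : i (iter n A' e) = Q (iter n T (i e)).
  elim: n => [|n IH] /=; first by rewrite Qid//; case: (iLe e).
  by rewrite hA IH QTQ.
have [yz oz] := iLe e.
have zy : M (i e) `<=` M y by exact: (orb_closure_min Tc).
have yz' : M y `<=` M (i e).
  have [zx|//] := gap _ zy.
  exfalso; move/negP: e0; apply; rewrite -normr_eq0 -hi normr_eq0; apply/eqP.
  by apply: (orthogonal_self hdot _ oz); apply: zx; exact: orb_closure_self.
apply/seteqP; split=> // v _ B /nbhs_ballP[r /= r0 rB].
have [yv ov] := iLe v.
have [_ [[n _ <-] +]] := yz' _ yv (ball (i v) r) (nbhsx_ballx _ _ r0).
rewrite -ball_normE /ball_/= => hn.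
exists (iter n A' e); split; first by exists n.
apply: rB; rewrite -ball_normE /ball_/= -hi linearB iter_A.
by rewrite -(Qid (i v))// -linearB (le_lt_trans (Qn _)).
Qed.

(** Without an orbit closure strictly between, all non-zero vectors have dense
    orbits under the compression: this rules out finite dimension, and also the
    invariant closed subset that exists in infinite dimension. *)
Lemma orbit_closures_dense x y : separable_space H ->
  (forall (E : completeNormedModType K) (A : {linear E -> E}),
     inf_dim_sep_hilbert E -> bounded_operator A ->
     exists F : set E, invariant_closed A F /\ nontrivial F) ->
  M x `<=` M y -> ~ M y `<=` M x ->
  exists z, [/\ M x `<=` M z, ~ M z `<=` M x, M z `<=` M y & ~ M y `<=` M z].
Proof.
move=> sepH inv xy nyx; apply: contrapT => nz.
have gap z : M z `<=` M y -> M z `<=` M x \/ M y `<=` M z.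
  move=> zy; have [|nzx] := pselect (M z `<=` M x); first by left.
  have [|nyz] := pselect (M y `<=` M z); first by right.
  exfalso; apply: nz; exists z; split=> //.
  by case: (Tu x z).
have [E [i [A [hi [is_ ic] Ab [e e0] Ad]]]] := compression_dense_orbits nyx xy gap.
have hE := isometry_inner_product hi.
have Einf : infinite_dimensional E.
  apply: (dense_orbit_infinite_dimensional hE _ e0 (Ad e e0)).
  exact: bounded_operator_continuous.
have [|F [[[f Ff] Fc AF] [F0 FT]]] := inv E A _ Ab.
  split=> //; first by apply/hilbert_inner_product; exists (fun e f => dot (i e) (i f)).
  exact: (isometry_separable hi).
have [g Fg g0] : exists2 g, F g & g != 0.
  apply: contrapT => h; apply: F0; apply/seteqP; split=> [g Fg|_ ->] /=.
    by apply/eqP/negPn/negP => g0; apply: h; exists g.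
  have [<-//|f0] := eqVneq f 0.
  by exfalso; apply: h; exists f.
apply: FT; apply/seteqP; split=> //; rewrite -(Ad g g0).
by apply: invariant_orb_closure => // z Fz; apply: AF; exists z.
Qed.
End Hilbert.

(** * Suprema of increasing sequences of orbit closures *)

Section Escape.
Variables (R : realType) (k : scalar_kind).
Local Notation K := (scalars R k).
Variables (H : completeNormedModType K) (dot : H -> H -> K).
Hypothesis hdot : inner_product dot.

Lemma geometric_series_cvg (u : nat -> H) :
  (forall n, `|u n| <= 2 ^- n.+1) ->
  exists x : H, (fun n => \sum_(i < n) u i) @ \oo --> x.
Proof.
move=> hu; pose s n := \sum_(i < n) u i.
(* The exact tail of the geometric series keeps the induction on [m] going. *)
have bound n m : `|s (m + n)%N - s n| <= 2 ^- n - 2 ^- (m + n).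
  elim: m => [|m IH]; first by rewrite add0n !subrr normr0.
  rewrite addSn /s big_ord_recr/= -/(s _) addrAC.
  rewrite (le_trans (ler_normD _ _))//.
  have -> : 2 ^- n - 2 ^- (m + n).+1 = (2 ^- n - 2 ^- (m + n)) + 2 ^- (m + n).+1 :> K.
    have -> : 2 ^- (m + n) = 2 ^- (m + n).+1 + 2 ^- (m + n).+1 :> K.
      by rewrite exprS invfM [X in _ + X]mulrC [X in X + _]mulrC -splitr.
    by rewrite opprD addrA subrK.
  by rewrite lerD.
apply/cvg_ex; apply: cauchy_cvg; apply/cauchy_exP => e e0.
have [n hn] := archi_pow2 e0.
exists (s n), n => // m /= nm; rewrite -ball_normE /ball_/= distrC.
rewrite -(subnK nm) (le_lt_trans (bound _ _))// (le_lt_trans _ hn)//.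
by rewrite gerBl invr_ge0 exprn_ge0.
Qed.

(** The vector is the sum of a rapidly convergent series whose terms [u n] lie in
    [N n.+1] and are orthogonal to [N n]. Its inner product with [u m] is the
    squared norm of [u m], so it is not in [N m] whenever [u m] is non-zero. *)
Lemma increasing_union_escape (N : nat -> set H) :
  (forall n, linear_subspace (N n)) -> (forall n, closed (N n)) ->
  (forall n, N n `<=` N n.+1) ->
  (forall n, exists2 m, (n <= m)%N & ~ N m.+1 `<=` N m) ->
  exists2 x, closure (\bigcup_n N n) x & forall n, ~ N n x.
Proof.
move=> Ns Nc Ninc Nstrict.
have Nmono n m : (n <= m)%N -> N n `<=` N m.
  move=> /subnK <-; elim: (m - n)%N => // d IH.
  by apply: subset_trans IH _; rewrite addSn.
have /choice[u hu] : forall n, exists u, [/\ N n.+1 u, orthogonal_to dot (N n) u,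
    `|u| <= 2 ^- n.+1 & (~ N n.+1 `<=` N n -> u != 0)].
  move=> n; have [sub|nsub] := pselect (N n.+1 `<=` N n).
    exists 0; split=> //; first by case: (Ns n.+1).
    - by case: (orthogonal_to_subspace hdot (N n)).
    - by rewrite normr0 invr_ge0 exprn_ge0.
  have [v Nv nv] : exists2 v, N n.+1 v & ~ N n v.
    apply: contrapT => h; apply: nsub => v Nv; apply: contrapT => nv.
    by apply: h; exists v.
  have [Q [QM Qo Qn]] := orthogonal_projection hdot (Ns n) (@Nc n).
  have Qv0 : Q v != 0.
    by apply: contra_notN nv => /eqP Qv0; have := QM v; rewrite Qv0 subr0.
  have NQv : N n.+1 (Q v).
    rewrite -(subKr v (Q v)); apply: (linear_subspaceB (Ns n.+1)) => //.
    exact: Ninc.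
  have nz : 0 < `|Q v| by rewrite normr_gt0.
  (* The component of [v] orthogonal to [N n], scaled to norm [2 ^- n.+1]. *)
  exists ((2 ^- n.+1 / `|Q v|) *: Q v); split.
  - exact: (linear_subspaceZ _ (Ns n.+1)).
  - exact: (linear_subspaceZ _ (orthogonal_to_subspace hdot (N n))).
  - rewrite normrZ ger0_norm ?divfK ?gt_eqF//.
    by rewrite divr_ge0 ?invr_ge0 ?exprn_ge0.
  - move=> _; rewrite scaler_eq0 negb_or Qv0 andbT mulf_neq0//.
      by rewrite invr_eq0 expf_neq0// pnatr_eq0.
    by rewrite invr_eq0 gt_eqF.
have [x hx] : exists x : H, (fun n => \sum_(i < n) u i) @ \oo --> x.
  by apply: geometric_series_cvg => n; case: (hu n).
pose s n := \sum_(i < n) u i.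
have Nsn n : N n (s n).
  rewrite /s; elim: n => [|n IH]; first by rewrite big_ord0; case: (Ns 0%N).
  rewrite big_ord_recr/=; apply: (linear_subspaceD (Ns n.+1)); first exact: Ninc.
  by case: (hu n).
exists x.
  apply: (@closed_cvg _ _ \oo _ s (closure (\bigcup_n N n)) _ _ x hx).
    exact: closed_closure.
  by apply: nearW => n; apply: subset_closure; exists n.
have dots m n : (m < n)%N -> dot (s n) (u m) = dot (u m) (u m).
  have [Num _ _ _] := hu m.
  elim: n => // n IH; rewrite ltnS /s big_ord_recr/= -/(s n) (dotDl hdot).
  rewrite leq_eqVlt => /predU1P[<-|mn].
    have [_ uo _ _] := hu m.
    by rewrite (dot_eq0C hdot (uo _ (Nsn m))) add0r.
  have [_ uo _ _] := hu n.
  by rewrite (uo (u m)) ?addr0 ?IH//; exact: (Nmono m.+1 n).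
have dotx m : orthogonal_to dot [set u m] (x - u m).
  apply: (@closed_cvg _ _ \oo _ (fun n => s n - u m) (orthogonal_to dot [set u m])).
  - exact: orthogonal_to_closed.
  - exists m.+1 => // n /= mn _ ->.
    by rewrite (dotBl hdot) dots// subrr.
  - by apply: cvgB => //; exact: cvg_cst.
move=> n Nx; have [m nm strict] := Nstrict n.
have [_ uo _ /(_ strict)] := hu m.
have xu : dot x (u m) = 0 by apply: (dot_eq0C hdot); apply: uo; exact: (Nmono n).
have := dotx m (u m) erefl; rewrite (dotBl hdot) xu sub0r (dotxx hdot) => /eqP.
by rewrite oppr_eq0 sqrf_eq0 normr_eq0 => ->.
Qed.

Variable T : {linear H -> H}.
Hypothesis Tb : bounded_operator T.
Hypothesis Ts : forall x, linear_subspace (orb_closure T x).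
Hypothesis Tu : orbit_unicellular T.
Local Notation M := (orb_closure T).

(** An escaping vector [x] generates the supremum: [M x] is not contained in any
    [M (a n)], so it contains them all, and [x] belongs to every closed set
    containing their union. *)
Lemma orbit_closures_sup (a : nat -> H) :
  (forall n, M (a n) `<=` M (a n.+1)) ->
  (forall n, exists2 m, (n <= m)%N & ~ M (a m.+1) `<=` M (a m)) ->
  exists x, (forall n, M (a n) `<=` M x) /\
    forall b, (forall n, M (a n) `<=` M b) -> M x `<=` M b.
Proof.
move=> inc strict; have Tc := bounded_operator_continuous Tb.
have [||x xcl nx] := @increasing_union_escape (fun n => M (a n)) _ _ inc strict.
- by [].
- by move=> n; exact: orb_closure_closed.
exists x; split=> [n|b hb].
  case: (Tu (a n) x) => // xa; exfalso; apply: (nx n); apply: xa.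
  exact: orb_closure_self.
apply: (orb_closure_min Tc); rewrite [M b](closure_id _).1; last exact: orb_closure_closed.
by apply: closure_subset xcl => z [n _]; exact: hb.
Qed.
End Escape.

(** * Copies of the real line in dense preorders *)

Definition strict (X : Type) (le : X -> X -> Prop) (x y : X) : Prop :=
  le x y /\ ~ le y x.

Section RealLine.
Variables (R : realType) (X : Type) (le : X -> X -> Prop).
Hypothesis rle_refl : forall x, le x x.
Hypothesis rle_trans : forall x y z, le x y -> le y z -> le x z.
Local Notation lt := (strict le).
Hypothesis lt_dense : forall x y, lt x y -> exists z, lt x z /\ lt z y.
Hypothesis strict_sup : forall a : nat -> X,
  (forall n, le (a n) (a n.+1)) ->
  (forall n, exists2 m, (n <= m)%N & ~ le (a m.+1) (a m)) ->
  exists x, (forall n, le (a n) x) /\ forall b, (forall n, le (a n) b) -> le x b.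

(** One step of a bisection between two elements, driven by the next binary digit
    of [r]. The test is not strict, so that numbers in ]0, 1] stay there and
    their expansions contain infinitely many digits 1; the left endpoint then
    increases infinitely often. *)
Definition bisect (mid : X -> X -> X) (s : X * X * R) : X * X * R :=
  let: (x, y, r) := s in
  if r <= 2^-1 then (x, mid x y, 2 * r) else (mid x y, y, 2 * r - 1).

(** Send [r] to the supremum of its left endpoints. Two different numbers follow
    the same path until their distance, doubled at each step, forces different
    digits; the right endpoint of the smaller one is then the left endpoint of
    the larger one. *)
Lemma unit_interval_embeds (p q : X) : lt p q ->
  exists phi : R -> X, forall r s, 0 < r -> r < s -> s <= 1 -> lt (phi r) (phi s).
Proof.
move=> pq.
have /choice[m2 hm2] : forall xy : X * X, exists z, lt xy.1 xy.2 -> lt xy.1 z /\ lt z xy.2.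
  move=> [x y] /=; have [xy|nxy] := pselect (lt x y); last by exists x.
  by have [z hz] := lt_dense xy; exists z.
pose mid x y := m2 (x, y).
have hmid x y : lt x y -> lt x (mid x y) /\ lt (mid x y) y by move=> /(hm2 (x, y)).
pose st r n := iter n (bisect mid) (p, q, r).
pose lo r n := (st r n).1.1; pose hi r n := (st r n).1.2.
pose rem r n := (st r n).2.
have stE r n : st r n = (lo r n, hi r n, rem r n) by rewrite /lo /hi /rem; case: (st r n) => [[]].
have stS r n : st r n.+1 = bisect mid (lo r n, hi r n, rem r n) by rewrite -stE.
have inv r n : lt (lo r n) (hi r n).
  elim: n => // n IH; have [h1 h2] := hmid _ _ IH.
  by rewrite /lo /hi stS /=; case: ifP.
have loS r n : le (lo r n) (lo r n.+1).
  by have [[h _] _] := hmid _ _ (inv r n); rewrite {2}/lo stS /=; case: ifP.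
have hiS r n : le (hi r n.+1) (hi r n).
  by have [_ [h _]] := hmid _ _ (inv r n); rewrite {1}/hi stS /=; case: ifP.
have lo_mono r n m : (n <= m)%N -> le (lo r n) (lo r m).
  move=> /subnK <-; elim: (m - n)%N => // d IH.
  by apply: rle_trans IH _; rewrite addSn.
have hi_mono r n m : (n <= m)%N -> le (hi r m) (hi r n).
  move=> /subnK <-; elim: (m - n)%N => // d IH.
  by apply: rle_trans _ IH; rewrite addSn.
have lo_hi r n m : le (lo r n) (hi r m).
  apply: (rle_trans (lo_mono r n (maxn n m) (leq_maxl _ _))).
  apply: rle_trans (hi_mono r m (maxn n m) (leq_maxr _ _)).
  by case: (inv r (maxn n m)).
have rem01 r n : 0 < r -> r <= 1 -> 0 < rem r n /\ rem r n <= 1.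
  move=> r0 r1; elim: n => // n [IH0 IH1]; rewrite /rem stS /=.
  by case: ifPn => [h|]; rewrite -?ltNge => *; split => /=; lra.
have pow2_unbounded (e : R) : 0 < e -> ~ forall n, 2 ^+ n * e <= 1.
  move=> e0 h; have [n] := @archi_pow2 R RealScalars _ e0.
  by rewrite -[ltLHS]mul1r ltr_pdivrMr ?exprn_gt0// ltNge mulrC h.
have frequent r : 0 < r -> r <= 1 -> forall n, exists2 m, (n <= m)%N & ~ le (lo r m.+1) (lo r m).
  move=> r0 r1 n; apply: contrapT => h.
  (* Only digits 0 from [n] on would double the positive remainder forever. *)
  have small m : (n <= m)%N -> rem r m <= 2^-1.
    move=> nm; rewrite leNgt; apply/negP => big; apply: h; exists m => //.
    rewrite {1}/lo stS /= leNgt big /=.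
    by case: (hmid _ _ (inv r m)) => -[].
  have dbl j : rem r (j + n)%N = 2 ^+ j * rem r n.
    elim: j => [|j IH]; first by rewrite mul1r.
    by rewrite addSn {1}/rem stS /= small ?leq_addl//= IH exprS mulrA.
  have [rn0 _] := rem01 r n r0 r1.
  apply: (pow2_unbounded _ rn0) => j; rewrite -dbl.
  by case: (rem01 r (j + n)%N r0 r1).
have /choice[phi hphi] : forall r, exists x, 0 < r -> r <= 1 ->
    (forall n, le (lo r n) x) /\ forall b, (forall n, le (lo r n) b) -> le x b.
  move=> r; have [r0|r0] := ltP 0 r; last by exists p.
  have [r1|r1] := leP r 1; last by exists p.
  by have [x hx] := strict_sup (loS r) (frequent r r0 r1); exists x.
exists phi => r s r0 rs s1.
have r1 : r <= 1 by lra.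
have s0 : 0 < s by lra.
have [m sep] : exists m, hi r m = lo s m.
  apply: contrapT => nsep.
  (* As long as the paths agree, the remainders stay in ]0, 1] while their
     difference doubles. *)
  have same n : [/\ lo r n = lo s n, hi r n = hi s n & rem s n - rem r n = 2 ^+ n * (s - r)].
    elim: n => [|n [el eh er]]; first by rewrite mul1r.
    have d0 : 0 < 2 ^+ n * (s - r) by rewrite mulr_gt0 ?exprn_gt0 ?subr_gt0.
    have ns : hi r n.+1 <> lo s n.+1 by move=> e; apply: nsep; exists n.+1.
    move: ns; rewrite /lo /hi /rem !stS /= el eh exprS -mulrA -er.
    have [hr|hr] := leP (rem r n) 2^-1; have [hs|hs] := leP (rem s n) 2^-1 => /= ns.
    - by split=> //; ring.
    - by [].
    - lra.
    - by split=> //; ring.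
  apply: (pow2_unbounded (s - r)); first by rewrite subr_gt0.
  move=> n; have [_ _ <-] := same n.
  have [] := rem01 r n r0 r1; have [] := rem01 s n s0 s1; lra.
have [rlo rmin] := hphi r r0 r1; have [slo smin] := hphi s s0 s1.
have rhi : le (phi r) (lo s m) by rewrite -sep; exact: rmin.
split; first exact: rle_trans rhi (slo m).
move=> sr; have [m' mm'] := frequent s s0 s1 m; apply.
apply: rle_trans (slo m'.+1) _; apply: rle_trans sr _.
by apply: rle_trans rhi _; exact: lo_mono.
Qed.

(** Compose with an increasing rational map from the line into the unit interval. *)
Lemma real_line_embeds (p q : X) : lt p q ->
  exists phi : R -> X, forall s t, s <= t <-> le (phi s) (phi t).
Proof.
move=> /unit_interval_embeds[phi hphi].
pose h (t : R) := (1 + t / (1 + `|t|)) / 2.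
have den t : 0 < 1 + `|t| :> R by rewrite ltr_pwDl.
have nrm t : t <= `|t| /\ - t <= `|t| :> R.
  by split; [exact: ler_norm|rewrite -normrN; exact: ler_norm].
have h0 t : 0 < h t.
  have [_ nt] := nrm t.
  have : - 1 < t / (1 + `|t|) by rewrite ltr_pdivlMr//; lra.
  by rewrite /h; lra.
have h1 t : h t <= 1.
  have [nt _] := nrm t.
  have : t / (1 + `|t|) <= 1 by rewrite ler_pdivrMr//; lra.
  by rewrite /h; lra.
have hmono s t : s < t -> h s < h t.
  move=> st; rewrite ltr_pM2r ?invr_gt0// ltrD2l.
  rewrite ltr_pdivrMr// mulrAC ltr_pdivlMr//.
  by have [s0|s0] := ger0P s; have [t0|t0] := ger0P t; nra.
have lt_phi s t : s < t -> lt (phi (h s)) (phi (h t)).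
  by move=> /hmono st; exact: hphi.
exists (phi \o h) => s t; split=> [|st] /=.
  by rewrite le_eqVlt => /predU1P[->//|/lt_phi[]].
by rewrite leNgt; apply/negP => /lt_phi[].
Qed.
End RealLine.

Lemma real_line_uncountable (R : realType) : ~ countable [set: R].
Proof.
move=> /countable_lebesgue_measure0 mu0.
have : (lebesgue_measure `[0%R : R, 1%R]%classic <= lebesgue_measure [set: R])%E.
  by apply: le_measure; rewrite ?inE.
rewrite mu0 lebesgue_measure_itv/= lte_fin ltr01 oppr0 adde0.
by rewrite lee_fin ler10.
Qed.

(** * The dichotomy *)

Theorem proposition1p4 (R : realType) (k : scalar_kind) :
  (exists (H : completeNormedModType (scalars R k)) (T : {linear H -> H}),
     [/\ inf_dim_sep_hilbert H,
         bounded_operator T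
       & ~ exists F : set H, invariant_closed T F /\ nontrivial F])
  \/
  (forall (H : completeNormedModType (scalars R k)) (T : {linear H -> H}),
     inf_dim_sep_hilbert H ->
     bounded_operator T ->
     (forall x : H, linear_subspace (orb_closure T x)) ->
     orbit_unicellular T ->
     (exists C : set (set H),
        C `<=` orb_closures T /\ order_iso_real R C)
     /\ ~ countable (orb_closures T)).
Proof.
have [ex|nex] := pselect (exists (H : completeNormedModType (scalars R k))
  (T : {linear H -> H}), [/\ inf_dim_sep_hilbert H, bounded_operator T
    & ~ exists F : set H, invariant_closed T F /\ nontrivial F]); first by left.
right=> H T [/hilbert_inner_product[dot hdot] Hinf Hsep] Tb Ts Tu.
have inv (E : completeNormedModType (scalars R k)) (A : {linear E -> E}) :
    inf_dim_sep_hilbert E -> bounded_operator A ->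
    exists F : set E, invariant_closed A F /\ nontrivial F.
  by move=> hE Ab; apply: contrapT => nF; apply: nex; exists E, A.
(* A non-zero vector exists, and its orbit closure lies strictly above [M 0]. *)
have [q q0] : exists q : H, q != 0.
  apply: contrapT => h; apply: Hinf; exists 0%N, (fun=> 0) => x.
  exists (fun=> 0); rewrite big_ord0; apply/eqP/negPn/negP => x0.
  by apply: h; exists x.
pose le (x y : H) := orb_closure T x `<=` orb_closure T y.
have T0n n : iter n T 0 = 0 by elim: n => //= n ->; rewrite linear0.
have lt0q : le 0 q /\ ~ le q 0.
  have M0 : orb_closure T 0 = [set 0].
    rewrite /orb_closure (_ : orb T 0 = [set 0]).
      rewrite -(closure_id [set 0]).1//; apply: accessible_closed_set1.
      exact: hausdorff_accessible (@norm_hausdorff _ _).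
    apply/seteqP; split=> [_ [n _ <-]|_ ->]; first exact: T0n.
    by exists 0%N.
  split; rewrite /le M0; first by move=> _ ->; case: (Ts q).
  by move=> /(_ q (@orb_closure_self _ _ T q)) /eqP; rewrite (negPf q0).
have [phi hphi] : exists phi : R -> H, forall s t, s <= t <-> le (phi s) (phi t).
  apply: (@real_line_embeds R H le _ _ _ _ 0 q) => //.
  - by move=> x; exact: subset_refl.
  - by move=> x y z; exact: subset_trans.
  - move=> x y [xy nyx].
    have [z [? ? ? ?]] := orbit_closures_dense hdot Tb Ts Tu Hsep inv xy nyx.
    by exists z.
  - by move=> a; exact: (orbit_closures_sup hdot Tb Ts Tu).
have inj : injective (fun t => orb_closure T (phi t)).
  by move=> s t e; apply/eqP; rewrite eq_le; apply/andP; split;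
    apply/hphi; rewrite /le e.
pose C : set (set H) := range (fun t => orb_closure T (phi t)).
have Csub : C `<=` orb_closures T by move=> _ [t _ <-]; exists (phi t).
split.
  exists C; split=> //; exists (fun t => orb_closure T (phi t)); split=> //.
  split=> [t _|s t _ _|_ [t _ <-]]; [by exists t|exact: inj|by exists t].
move=> /(sub_countable (subset_card_le Csub)) Cc.
apply: (@real_line_uncountable R).
by rewrite -(eq_countable (inj_card_eq (A := setT) (in2W inj))).
Qed.
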